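(* Let $m\ge 3$, let $i\neq j$ be two indices in $\{1,\dots,m-1\}$, let $\Sigma$ be a positive integer, and let $n$ be a nonnegative integer. Consider the $(m-1)$-tuple $T=(\Sigma_1,\dots,\Sigma_{m-1})$ with $\Sigma_i=\Sigma$, $\Sigma_j=1$ and $\Sigma_l=0$ for all other $l$. Then the number of partitions of $n$ in which every part occurs at most $m-1$ times and whose alternating sum type (for modulus $m$) is $T$ equals the number of partitions of $n$ with no part divisible by $m$ that have exactly $\Sigma$ parts congruent to $i$ modulo $m$, exactly one part congruent to $j$ modulo $m$, and no other parts.
   Context: For a partition $\lambda_1\ge\lambda_2\ge\dots\ge\lambda_r>0$ and modulus $m\ge2$, append zero parts $\lambda_{r+1}=\lambda_{r+2}=\dots=0$ so that its length becomes a multiple $km$ of $m$ (zeros are allowed as parts for this purpose only). The alternating sum type of $\lambda$ is the $(m-1)$-tuple $(\Sigma_1,\dots,\Sigma_{m-1})$ with $\Sigma_l=\sum_{s=1}^{k}\big(\lambda_{(s-1)m+l}-\lambda_{(s-1)m+l+1}\big)$ for $1\le l\le m-1$. *)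

(* Defs.v *)
From mathcomp Require Import all_boot.

Set Implicit Arguments.
Unset Strict Implicit.
Unset Printing Implicit Defensive.

(* Partitions are nonincreasing lists of positive integers. *)
Definition is_partition_of (n : nat) (lam : seq nat) : bool :=
  [&& sorted geq lam, 0 \notin lam & sumn lam == n].

(* A partition of n has at most n parts, each at most n, so the partitions of n
   live in the finite type n.-bseq 'I_n.+1; see partition_bseq below. *)
Definition num_partitions (n : nat) (P : pred (seq nat)) : nat :=
  #|[set b : n.-bseq 'I_n.+1 |
      is_partition_of n (map val b) && P (map val b)]|.

Lemma partition_bseq (n : nat) (lam : seq nat) :
  is_partition_of n lam -> exists b : n.-bseq 'I_n.+1, map val b = lam.
Proof.
case/and3P=> _ lam0 /eqP lamn.
have le_size : size lam <= n.
  rewrite -lamn; elim: lam lam0 {lamn} => //= x s IHs.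
  rewrite inE negb_or eq_sym -lt0n => /andP[x_gt0 /IHs le_s].
  by rewrite -add1n leq_add.
have le_part : all (fun x => x < n.+1) lam.
  apply/allP => x; rewrite ltnS -lamn {lam0 lamn le_size}.
  elim: lam => //= y s IHs; rewrite inE => /orP[/eqP-> | /IHs le_xs].
    exact: leq_addr.
  exact: leq_trans le_xs (leq_addl _ _).
have le_size' : size [seq inord x : 'I_n.+1 | x <- lam] <= n by rewrite size_map.
exists (Bseq le_size') => /=; rewrite -map_comp -[RHS]map_id.
by apply/eq_in_map => x /(allP le_part) /= /inordK.
Qed.

(* 1-based; the zero parts appended to lam are the default values of nth. *)
Definition part (lam : seq nat) (t : nat) : nat := nth 0 lam t.-1.

(* k = ceil (size lam / m).  When lam is nonincreasing, which is the only case
   in use, the truncated subtraction below agrees with the integer one. *)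
Definition alt_sum (m : nat) (lam : seq nat) (l : nat) : nat :=
  let k := (size lam + m.-1) %/ m in
  \sum_(1 <= s < k.+1)
    (part lam ((s - 1) * m + l) - part lam ((s - 1) * m + l + 1)).

(* Entry l : 'I_m.-1 is the component of (1-based) index l + 1. *)
Definition alt_sum_type (m : nat) (lam : seq nat) : m.-1.-tuple nat :=
  [tuple alt_sum m lam l.+1 | l < m.-1].

Definition two_entry_type (m i j Sigma : nat) : m.-1.-tuple nat :=
  [tuple if l.+1 == i then Sigma else if l.+1 == j then 1 else 0 | l < m.-1].

Definition parts_occur_at_most (c : nat) (lam : seq nat) : bool :=
  all (fun x => count_mem x lam <= c) lam.

Definition no_part_divisible (m : nat) (lam : seq nat) : bool :=
  all (fun x => ~~ (m %| x)) lam.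

Definition num_parts_congr (m i : nat) (lam : seq nat) : nat :=
  count (fun x => x == i %[mod m]) lam.

(* Main.v *)
(* Removing m copies of a part as often as possible writes a partition uniquely
   as a partition with multiplicities below m together with m copies of an
   arbitrary partition nu, and keeps the alternating sum type.  Likewise,
   splitting off the multiples of m writes a partition uniquely as an m-regular
   one together with m * nu, and keeps the number of parts in each nonzero
   residue class.  Since the l-th alternating sum counts the parts of the
   conjugate that are congruent to l, conjugation shows that prescribing the
   alternating sum type or the residue counts gives equally many partitions of
   n.  Hence the two sides of the theorem have the same convolution with the
   partition function, which can be cancelled. *)

Require Import Defs.
From mathcomp Require Import all_boot.
From mathcomp Require Import zify.

Set Implicit Arguments.
Unset Strict Implicit.
Unset Printing Implicit Defensive.

(** * Counting partitions through an explicit list *)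

(** A duplicate-free list turns [num_partitions] into [count], so that bijections reduce to
    comparing the members of two lists. *)
Definition partitions (n : nat) : seq (seq nat) :=
  [seq map val (val b) | b <- enum [set b : n.-bseq 'I_n.+1 |
                                      is_partition_of n (map val b)]].

Lemma partitions_uniq n : uniq (partitions n).
Proof.
rewrite map_inj_uniq ?enum_uniq // => b c eq_bc.
exact/val_inj/(inj_map val_inj).
Qed.

Lemma mem_partitions n lam : (lam \in partitions n) = is_partition_of n lam.
Proof.
apply/mapP/idP => [[b + ->] | lamP]; first by rewrite mem_enum inE.
have [b lamE] := partition_bseq lamP; exists b => //.
by rewrite mem_enum inE lamE.
Qed.

Lemma num_partitionsE n P : num_partitions n P = count P (partitions n).
Proof.
rewrite /num_partitions cardE count_map -size_filter /enum_mem -filter_predI.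
by congr size; apply: eq_filter => b; rewrite !inE /= andbC.
Qed.

Lemma eq_num_partitions n P Q :
  (forall lam, is_partition_of n lam -> P lam = Q lam) ->
  num_partitions n P = num_partitions n Q.
Proof.
move=> eqPQ; rewrite !num_partitionsE; apply: eq_in_count => lam.
by rewrite mem_partitions; apply: eqPQ.
Qed.

Lemma is_partition_sumn n lam : is_partition_of n lam -> sumn lam = n.
Proof. by case/and3P=> _ _ /eqP. Qed.

Lemma is_partition_sort n s :
  0 \notin s -> sumn s = n -> is_partition_of n (sort geq s).
Proof.
move=> s0 <-; apply/and3P; split; first by apply: sort_sorted => x y; lia.
  by rewrite mem_sort.
by rewrite (perm_sumn (permEl (perm_sort _ _))).
Qed.

Lemma sorted_geq_eq s t :
  sorted geq s -> sorted geq t -> perm_eq s t -> s = t.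
Proof. by apply: sorted_eq => [x y z|x y]; rewrite /geq /=; lia. Qed.

Lemma partition_eq n n' lam mu :
  is_partition_of n lam -> is_partition_of n' mu -> perm_eq lam mu -> lam = mu.
Proof. by case/and3P=> slam _ _ /and3P[smu _ _]; apply: sorted_geq_eq. Qed.

(** Classification by the statistic [w]: each counted partition lies in exactly one class, because
    [N] exceeds all values taken. *)
Lemma num_partitions_sum n (P : pred (seq nat)) (w : seq nat -> nat) N :
  (forall lam, is_partition_of n lam -> P lam -> w lam < N) ->
  num_partitions n P =
  \sum_(b < N) num_partitions n (fun lam => P lam && (w lam == b)).
Proof.
move=> wN; rewrite num_partitionsE -sum1_count.
under [RHS]eq_bigr => b _ do rewrite num_partitionsE -sum1_count.
under [RHS]eq_bigr => b _ do rewrite big_mkcondr.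
rewrite exchange_big /= [LHS]big_seq_cond [RHS]big_seq_cond.
apply: eq_bigr => lam /andP[lamP Plam].
have ltwN : w lam < N by apply: wN => //; rewrite -mem_partitions.
rewrite (bigD1 (Ordinal ltwN)) //= eqxx big1 ?addn0 // => b.
by rewrite -val_eqE /= eq_sym => /negPf->.
Qed.

(** * Factoring out an arbitrary partition, and cancelling it *)

(** The pair of [f] and [g] inverts [phi], so a partition satisfying [P] amounts to a core
    satisfying [P] and [D] together with an arbitrary partition of some [b], which contributes
    [m * b]. *)
Lemma num_partitions_factor m (P D : pred (seq nat))
    (phi : seq nat -> seq nat -> seq nat) (f g : seq nat -> seq nat) :
  0 < m ->
  (forall a b lam nu, is_partition_of a lam -> is_partition_of b nu ->
    P lam -> D lam ->
    [/\ is_partition_of (a + m * b) (phi lam nu), P (phi lam nu),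
        f (phi lam nu) = lam & g (phi lam nu) = nu]) ->
  (forall n lam, is_partition_of n lam -> P lam ->
    exists a b, [/\ n = a + m * b, is_partition_of a (f lam),
      is_partition_of b (g lam), P (f lam) && D (f lam)
      & phi (f lam) (g lam) = lam]) ->
  forall n, num_partitions n P =
  \sum_(b < (n %/ m).+1)
     num_partitions (n - m * b) (fun lam => P lam && D lam)
     * num_partitions b predT.
Proof.
move=> m_gt0 phiP fgP n.
(* The weight is the [b] in [n = a + m * b], hence at most [n %/ m]. *)
rewrite (@num_partitions_sum n P (sumn \o g) (n %/ m).+1); last first.
  move=> lam lamP Plam; have [a [b [nE _ gP _ _]]] := fgP _ _ lamP Plam.
  by rewrite /= (is_partition_sumn gP) ltnS leq_divRL // nE; lia.
apply: eq_bigr => -[b /= ltb] _.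
rewrite ltnS leq_divRL // in ltb.
rewrite !num_partitionsE count_predT -!size_filter.
set s := filter _ (partitions n); set t := filter _ (partitions (n - _)).
(* The images of [s] under [f] and [g] and the pairs from [t] and the partitions of [b] are
   duplicate-free lists with the same members. *)
rewrite -(size_allpairs pair) -(size_map (fun lam => (f lam, g lam)) s).
apply/perm_size/uniq_perm.
- rewrite map_inj_in_uniq ?filter_uniq ?partitions_uniq // => lam mu.
  rewrite !mem_filter !mem_partitions => /andP[/andP[Plam _] lamP].
  move=> /andP[/andP[Pmu _] muP] [eqf eqg].
  have [_ [_ [_ _ _ _ <-]]] := fgP _ _ lamP Plam.
  by have [_ [_ [_ _ _ _ <-]]] := fgP _ _ muP Pmu; rewrite eqf eqg.
- by apply: allpairs_uniq => [||[? ?] [? ?] _ _ //];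
    rewrite ?filter_uniq ?partitions_uniq.
move=> [lam nu]; apply/mapP/allpairsP => [[mu muP [-> ->]] | [[lam' nu'] /=]].
  move: muP; rewrite mem_filter mem_partitions => /andP[/andP[Pmu /eqP/= gb]].
  move=> muP; exists (f mu, g mu).
  have [a [b' [nE fP gP PDf _]]] := fgP _ _ muP Pmu.
  have b'E : b' = b by rewrite -gb (is_partition_sumn gP).
  rewrite b'E in nE gP; have aE : n - m * b = a by lia.
  by rewrite mem_filter !mem_partitions /= PDf aE.
rewrite mem_filter !mem_partitions => -[/andP[/andP[Plam Dlam] lamP] nuP].
case=> -> ->; have [phiP' Pphi fE gE] := phiP _ _ _ _ lamP nuP Plam Dlam.
exists (phi lam' nu'); last by rewrite fE gE.
rewrite mem_filter mem_partitions Pphi /= gE (is_partition_sumn nuP) eqxx /=.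
by move: phiP'; rewrite subnK // mulnC.
Qed.

(** Strong induction on [n]: the term [b = 0] is [F n] because [p 0 = 1], and the others involve
    smaller arguments, where [F] and [G] already agree. *)
Lemma convolution_cancel m (F G p : nat -> nat) : 0 < m -> p 0 = 1 ->
  (forall n, \sum_(b < (n %/ m).+1) F (n - m * b) * p b
           = \sum_(b < (n %/ m).+1) G (n - m * b) * p b) ->
  F =1 G.
Proof.
move=> m_gt0 p0 eqFG; elim/ltn_ind => n IHn.
have := eqFG n; rewrite !big_ord_recl muln0 subn0 p0 !muln1.
rewrite (eq_bigr (fun b : 'I_(n %/ m) => G (n - m * b.+1) * p b.+1)).
  by move/addIn.
move=> [b ltb] _ /=; rewrite /bump /= add1n IHn //.
have : m * b.+1 <= n by rewrite mulnC -leq_divRL.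
by move: m_gt0; nia.
Qed.

Lemma num_partitions0 : num_partitions 0 predT = 1.
Proof.
rewrite num_partitionsE count_predT.
rewrite -[1]/(size [:: [::] : seq nat]); apply/perm_size/uniq_perm => //.
  exact: partitions_uniq.
move=> lam; rewrite mem_partitions inE /is_partition_of.
case: lam => [|x s] //=; rewrite inE; case: x => [|x]; rewrite ?andbF //=.
Qed.

(** * Splitting multiplicities modulo [m] *)

Definition repeat_parts m (nu : seq nat) := flatten (nseq m nu).

Definition add_repeated m lam nu := sort geq (lam ++ repeat_parts m nu).

(** With [c] the remainder or the quotient by [m], this yields the two components that
    [add_repeated] puts together. *)
Definition map_mult (c : nat -> nat) (lam : seq nat) :=
  sort geq (flatten [seq nseq (c (count_mem x lam)) x | x <- undup lam]).

Lemma count_repeat_parts m a nu :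
  count a (repeat_parts m nu) = m * count a nu.
Proof. by rewrite count_flatten map_nseq sumn_nseq mulnC. Qed.

Lemma count_map_mult c lam x : c 0 = 0 ->
  count_mem x (map_mult c lam) = c (count_mem x lam).
Proof.
move=> c0; rewrite count_sort count_flatten -map_comp.
rewrite sumnE big_map; have [xlam | xlam] := boolP (x \in lam).
  rewrite (bigD1_seq x) ?undup_uniq ?mem_undup //= count_nseq /= eqxx mul1n.
  by rewrite big1 ?addn0 // => y /negPf neq; rewrite count_nseq /= neq.
rewrite (count_memPn xlam) c0 big_seq big1 // => y.
rewrite mem_undup => ylam; rewrite /= count_nseq /=; case: eqVneq => // yx.
by rewrite -yx ylam in xlam.
Qed.

Lemma map_mult_partition c lam : 0 \notin lam ->
  is_partition_of (sumn (map_mult c lam)) (map_mult c lam).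
Proof.
move=> lam0; rewrite (perm_sumn (permEl (perm_sort _ _))).
apply: is_partition_sort => //; apply/flattenP => -[_ /mapP[x + ->]].
rewrite mem_undup => xlam /nseqP[x0 _].
by rewrite x0 xlam in lam0.
Qed.

Lemma sumn_add_repeated m lam nu :
  sumn (add_repeated m lam nu) = sumn lam + m * sumn nu.
Proof.
rewrite (perm_sumn (permEl (perm_sort _ _))) sumn_cat; congr addn.
by elim: m => //= m IHm; rewrite sumn_cat IHm mulSn.
Qed.

Lemma count_add_repeated m a lam nu :
  count a (add_repeated m lam nu) = count a lam + m * count a nu.
Proof. by rewrite count_sort count_cat count_repeat_parts. Qed.

Lemma add_repeated_partition m a b lam nu :
  is_partition_of a lam -> is_partition_of b nu ->
  is_partition_of (a + m * b) (add_repeated m lam nu).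
Proof.
move=> /and3P[_ lam0 /eqP<-] /and3P[_ nu0 /eqP<-].
rewrite -sumn_add_repeated (perm_sumn (permEl (perm_sort _ _))).
apply: is_partition_sort => //; rewrite mem_cat negb_or lam0 /=.
apply/count_memPn; rewrite count_repeat_parts (count_memPn nu0); exact: muln0.
Qed.

Lemma parts_occur_at_mostP c lam :
  reflect (forall x, count_mem x lam <= c) (parts_occur_at_most c lam).
Proof.
apply: (iffP allP) => [le_c x | le_c x _]; last exact: le_c.
by have [/le_c | /count_memPn->] := boolP (x \in lam).
Qed.

(** Euclidean division of each multiplicity by [m]: the remainders form a partition with
    multiplicities at most [m - 1], the quotients an arbitrary [nu]. *)
Lemma num_partitions_glaisher m (P : pred (seq nat)) : 0 < m ->
  (forall a b lam nu, is_partition_of a lam -> is_partition_of b nu ->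
     P (add_repeated m lam nu) = P lam) ->
  forall n, num_partitions n P =
  \sum_(b < (n %/ m).+1)
     num_partitions (n - m * b)
       (fun lam => P lam && parts_occur_at_most (m - 1) lam)
     * num_partitions b predT.
Proof.
move=> m_gt0 Padd.
apply: (num_partitions_factor (phi := add_repeated m) (f := map_mult (modn^~ m))
          (g := map_mult (divn^~ m))) => //.
- move=> a b lam nu lamP nuP Plam /parts_occur_at_mostP lam_m.
  have addP := add_repeated_partition m lamP nuP.
  have add0 : 0 \notin add_repeated m lam nu by case/and3P: addP.
  split=> //; first by rewrite (Padd a b).
    apply: (partition_eq (map_mult_partition _ add0) lamP).
    (* [perm_eq] unfolds to equality of multiplicities; here a number below [m] plus a multiple of
       [m] is reduced modulo [m]. *)
    apply/allP => x _ /=; rewrite count_map_mult ?mod0n //.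
    rewrite count_add_repeated mulnC addnC modnMDl.
    by rewrite modn_small // (leq_ltn_trans (lam_m x)) //; lia.
  apply: (partition_eq (map_mult_partition _ add0) nuP); apply/allP => x _ /=.
  rewrite count_map_mult ?div0n // count_add_repeated mulnC addnC divnMDl //.
  by rewrite divn_small ?addn0 // (leq_ltn_trans (lam_m x)) //; lia.
move=> n lam lamP Plam; have lam0 : 0 \notin lam by case/and3P: lamP.
have fP := map_mult_partition (modn^~ m) lam0.
have gP := map_mult_partition (divn^~ m) lam0.
have addK : add_repeated m (map_mult (modn^~ m) lam) (map_mult (divn^~ m) lam)
            = lam.
  apply: (partition_eq (add_repeated_partition m fP gP) lamP).
  apply/allP => x _ /=; rewrite count_add_repeated.
  by rewrite !count_map_mult ?mod0n ?div0n // mulnC addnC -divn_eq.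
exists (sumn (map_mult (modn^~ m) lam)), (sumn (map_mult (divn^~ m) lam)).
split=> //; first by rewrite -sumn_add_repeated addK (is_partition_sumn lamP).
rewrite -(Padd _ _ _ _ fP gP) addK Plam; apply/parts_occur_at_mostP => x.
rewrite count_map_mult ?mod0n //.
by have := ltn_pmod (count_mem x lam) m_gt0; lia.
Qed.

(** * Splitting off the multiples of [m] *)

Definition add_multiples m lam nu := sort geq (lam ++ map (muln m) nu).

Lemma add_multiples_partition m a b lam nu : 0 < m ->
  is_partition_of a lam -> is_partition_of b nu ->
  is_partition_of (a + m * b) (add_multiples m lam nu).
Proof.
move=> m_gt0 /and3P[_ lam0 /eqP<-] /and3P[_ nu0 /eqP<-].
apply: is_partition_sort.
  rewrite mem_cat negb_or lam0 /=; apply: contra nu0 => /mapP[y ynu].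
  by move/esym/eqP; rewrite muln_eq0 -[m == 0]negbK -lt0n m_gt0 => /eqP<-.
rewrite sumn_cat; congr addn.
by elim: {nu0} nu => [|y s IHs] /=; rewrite ?muln0 // IHs mulnDr.
Qed.

Lemma filter_partition (a : pred nat) lam : sorted geq lam -> 0 \notin lam ->
  is_partition_of (sumn (filter a lam)) (filter a lam).
Proof.
move=> slam lam0; rewrite /is_partition_of eqxx andbT.
rewrite mem_filter (negPf lam0) andbF andbT.
by apply: sorted_filter slam => x y z; rewrite /geq /=; lia.
Qed.

(** To invert [add_multiples], the parts not divisible by [m] are kept as the regular component, and
    the others are divided by [m] to give [nu]. *)
Lemma num_partitions_regular m (P : pred (seq nat)) : 0 < m ->
  (forall a b lam nu, is_partition_of a lam -> is_partition_of b nu ->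
     P (add_multiples m lam nu) = P lam) ->
  forall n, num_partitions n P =
  \sum_(b < (n %/ m).+1)
     num_partitions (n - m * b) (fun lam => P lam && no_part_divisible m lam)
     * num_partitions b predT.
Proof.
move=> m_gt0 Padd.
pose f := filter (fun x => ~~ (m %| x)).
pose g lam := map (divn^~ m) (filter (dvdn m) lam).
apply: (num_partitions_factor (phi := add_multiples m) (f := f) (g := g)) => //.
- move=> a b lam nu lamP nuP Plam /allP lam_m.
  have addP := add_multiples_partition m_gt0 lamP nuP.
  have [sadd add0 _] := and3P addP; have [slam _ _] := and3P lamP.
  have [snu _ _] := and3P nuP.
  have geq_trans : transitive geq by move=> x y z; rewrite /geq /=; lia.
  have geq_total : total geq by move=> x y; rewrite /geq /=; lia.
  split=> //; first by rewrite (Padd a b).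
    rewrite /f /add_multiples filter_sort // filter_cat.
    rewrite (all_filterP (introT allP lam_m)).
    rewrite (_ : filter _ (map _ nu) = [::]) ?cats0; first exact: sorted_sort.
    by elim: {nuP snu addP sadd add0} nu => //= x s ->; rewrite dvdn_mulr.
  rewrite /g /add_multiples filter_sort // filter_cat.
  rewrite (_ : filter _ lam = [::]) /=; last first.
    by apply/eqP; rewrite -[_ == _]negbK -has_filter; apply/hasPn.
  rewrite (_ : filter _ (map _ nu) = map (muln m) nu); last first.
    by apply/all_filterP/allP => _ /mapP[x _ ->]; rewrite dvdn_mulr.
  rewrite sorted_sort //; last first.
    by rewrite sorted_map; apply: sub_sorted snu => x y;
      rewrite /geq /= leq_pmul2l.
  by rewrite -map_comp map_id_in // => x _ /=; rewrite mulKn.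
move=> n lam lamP Plam; have [slam lam0 _] := and3P lamP.
have fP : is_partition_of (sumn (f lam)) (f lam) by apply: filter_partition.
have gP : is_partition_of (sumn (g lam)) (g lam).
  rewrite /is_partition_of eqxx andbT; apply/andP; split.
    rewrite sorted_map.
    have [/sub_sorted + _ _] := and3P (filter_partition (dvdn m) slam lam0).
    by apply=> x y; apply: leq_div2r.
  apply/mapP => -[x]; rewrite mem_filter => /andP[mx xlam] /esym/eqP.
  apply/negP; rewrite -lt0n divn_gt0 //.
  by apply: dvdn_leq => //; rewrite lt0n; apply: contraNneq lam0 => <-.
have perm_add : perm_eq (f lam ++ map (muln m) (g lam)) lam.
  rewrite -map_comp map_id_in; last first.
    by move=> x; rewrite mem_filter => /andP[mx _] /=; rewrite mulnC divnK.
  by rewrite perm_catC perm_filterC.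
have addK : add_multiples m (f lam) (g lam) = lam.
  apply: (partition_eq (add_multiples_partition m_gt0 fP gP) lamP).
  by rewrite perm_sort.
exists (sumn (f lam)), (sumn (g lam)); split=> //.
  have := is_partition_sumn (add_multiples_partition m_gt0 fP gP).
  by rewrite addK (is_partition_sumn lamP).
by rewrite -(Padd _ _ _ _ fP gP) addK Plam /= /no_part_divisible filter_all.
Qed.

(** * Conjugation *)

(** Column lengths of the Young diagram: [leq x] holds of the parts that are at least [x], and the
    head of a nonincreasing list is its largest part. *)
Definition conjugate (lam : seq nat) :=
  [seq count (leq x) lam | x <- iota 1 (head 0 lam)].

(** The parts that are at least [x] form an initial segment, and [t] is a 0-based position. Past the
    end of the list, the default 0 stays below [x]. *)
Lemma leq_nth_count lam x t : sorted geq lam -> 0 < x ->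
  (x <= nth 0 lam t) = (t < count (leq x) lam).
Proof.
move=> + x_gt0; elim: lam t => [|y s IHs] t /=; first by rewrite nth_nil; lia.
move=> path_s; have s_le_y : all (fun z => z <= y) s.
  by apply: order_path_min path_s => a b c; rewrite /geq /=; lia.
have {}IHs := IHs _ (path_sorted path_s).
have [le_xy | lt_yx] := leqP x y.
  by case: t => [|t] /=; rewrite ?IHs ?le_xy.
have count0 : count (leq x) s = 0.
  apply/eqP; rewrite -leqn0 leqNgt -has_count.
  by apply/hasPn => z /(allP s_le_y); lia.
by case: t => [|t] /=; rewrite ?IHs count0; lia.
Qed.

Lemma leq_head lam x : sorted geq lam -> x \in lam -> x <= head 0 lam.
Proof.
case: lam => //= y s path_s; rewrite inE => /predU1P[-> // |].
have /allP : all (geq y) s.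
  by apply: order_path_min path_s => a b c; rewrite /geq /=; lia.
by move=> + xs => /(_ _ xs).
Qed.

Lemma count_leq_iota N y : y <= N -> count (fun x => x <= y) (iota 1 N) = y.
Proof.
move=> le_yN; rewrite -(subnKC le_yN) iotaD count_cat.
rewrite (_ : count _ (iota 1 y) = y); last first.
  rewrite -[RHS](size_iota 1); apply/eqP; rewrite -all_count.
  by apply/allP => x; rewrite mem_iota; lia.
rewrite (_ : count _ _ = 0) ?addn0 //; apply/eqP.
by rewrite -leqn0 leqNgt -has_count; apply/hasPn => x; rewrite mem_iota; lia.
Qed.

(** Counts the cells of the Young diagram by columns and by rows. *)
Lemma sumn_conjugate lam : sorted geq lam -> sumn (conjugate lam) = sumn lam.
Proof.
move=> slam; rewrite /conjugate !sumnE big_map.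
under eq_bigr do rewrite -sum1_count big_mkcond.
rewrite exchange_big /= !big_seq; apply: eq_bigr => y ylam.
by rewrite -big_mkcond sum1_count count_leq_iota ?leq_head.
Qed.

Lemma conjugate_partition n lam :
  is_partition_of n lam -> is_partition_of n (conjugate lam).
Proof.
case/and3P=> slam lam0 /eqP<-; rewrite /is_partition_of sumn_conjugate // eqxx.
rewrite andbT; apply/andP; split.
  rewrite sorted_map; apply: (@sub_sorted _ leq); last exact: iota_sorted.
  by move=> x y le_xy; apply: sub_count => z /=; apply: leq_trans.
apply/mapP => -[x]; rewrite mem_iota => xP /esym/eqP.
apply/negP; rewrite -lt0n -leq_nth_count //; last by lia.
by rewrite nth0; lia.
Qed.

Lemma head_conjugate lam : 0 \notin lam -> head 0 (conjugate lam) = size lam.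
Proof.
case: lam => [|[|x] s] //= lam0; apply/eqP.
rewrite -[(size s).+1]/(size (x.+1 :: s)) -[_ + _]/(count (leq 1) (x.+1 :: s)).
by rewrite -all_count; apply/allP => y; case: y => // /(negP lam0).
Qed.

(** Entry [t] of the double conjugate counts the columns [x] longer than [t]; by [leq_nth_count]
    these are the positive [x] up to [nth 0 lam t]. *)
Lemma conjugateK n lam :
  is_partition_of n lam -> conjugate (conjugate lam) = lam.
Proof.
case/and3P=> slam lam0 _; rewrite {1}/conjugate head_conjugate //.
(* Shifts the range starting at 1 to the 0-based positions of [nth]. *)
rewrite -[RHS](mkseq_nth 0) /mkseq -[1]/(1 + 0) iotaDl -map_comp.
apply: eq_map => t /=; rewrite add1n /conjugate count_map.
rewrite -[RHS](@count_leq_iota (head 0 lam)); last first.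
  have [lt_t | /(nth_default 0)->//] := ltnP t (size lam).
  by rewrite leq_head ?mem_nth.
apply: eq_in_count => x; rewrite mem_iota => /andP[x_gt0 _] /=.
by rewrite leq_nth_count.
Qed.

(** * Alternating sums as residue counts *)

(** At most the term with [s - 1 = c %/ m] is nonzero, and it is so exactly when [c] has residue
    [l]. *)
Lemma sum_eq_modn m k l c : 0 < l < m -> c <= k * m ->
  \sum_(1 <= s < k.+1) (c == (s - 1) * m + l) = (c == l %[mod m]).
Proof.
move=> /andP[l_gt0 lt_lm] le_c; have m_gt0 : 0 < m by lia.
rewrite (modn_small lt_lm) big_add1 /= big_mkord.
have eqE s : (c == (s.+1 - 1) * m + l) = (c %% m == l) && (s == c %/ m).
  rewrite subn1 /=; apply/eqP/andP => [-> | [/eqP<- /eqP->]].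
    by rewrite modnMDl divnMDl // modn_small // divn_small // addn0.
  exact: divn_eq.
under eq_bigr do rewrite eqE.
have [cl | _] := eqVneq (c %% m) l; last by rewrite big1.
(* The boundary value [c = k * m] has residue 0, which [0 < l] rules out. *)
have lt_k : c %/ m < k.
  by rewrite ltn_divLR // ltn_neqAle le_c andbT; apply: contraTneq l_gt0 => ck;
    rewrite -cl ck modnMl.
rewrite (bigD1 (Ordinal lt_k)) //= eqxx big1 // => s.
by rewrite -val_eqE /= => /negPf->.
Qed.

(** The difference of parts [t] and [t + 1] is the number of [x] with exactly [t] parts at least
    [x]. An [x] above the largest part gives 0, which is not congruent to [l], so any upper bound
    [N] serves. *)
Lemma alt_sumE m lam l N : 0 < l < m -> sorted geq lam ->
  all (fun y => y <= N) lam ->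
  alt_sum m lam l = count (fun x => count (leq x) lam == l %[mod m]) (iota 1 N).
Proof.
move=> lP slam lamN; have m_gt0 : 0 < m by lia.
rewrite /alt_sum; set k := (_ %/ m).
have diffE t : 0 < t ->
    part lam t - part lam (t + 1) =
    \sum_(x <- iota 1 N) (count (leq x) lam == t).
  case: t => // t _; rewrite /part addn1 /=.
  have nthN u : nth 0 lam u <= N.
    have [lt_u | /(nth_default 0)->//] := ltnP u (size lam).
    by rewrite (allP lamN) ?mem_nth.
  have nthE u : nth 0 lam u = \sum_(x <- iota 1 N) (u < count (leq x) lam).
    rewrite -[LHS](count_leq_iota (nthN u)) -sum1_count big_mkcond !big_seq.
    apply: eq_bigr => x; rewrite mem_iota => /andP[x_gt0 _].
    by rewrite leq_nth_count //; case: ltnP.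
  rewrite !nthE -sumnB => [|x _]; last by lia.
  by apply: eq_bigr => x _; lia.
rewrite (eq_big_nat _ _ (F2 := fun s =>
  \sum_(x <- iota 1 N) (count (leq x) lam == (s - 1) * m + l))); last first.
  by move=> s _; rewrite diffE // addn_gt0; case/andP: lP => -> _; rewrite orbT.
rewrite exchange_big -sum1_count [RHS]big_mkcond /=; apply: eq_bigr => x _.
(* [k] is the ceiling of [size lam / m], so no count exceeds [k * m]. *)
have le_size : size lam <= k * m.
  have := divn_eq (size lam + m.-1) m; have := ltn_pmod (size lam + m.-1) m_gt0.
  by rewrite -/k; lia.
rewrite sum_eq_modn ?(leq_trans (count_size _ _)) //.
Qed.

Lemma leq_sumn x lam : x \in lam -> x <= sumn lam.
Proof.
elim: lam => //= y s IHs; rewrite inE => /predU1P[->|/IHs].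
  exact: leq_addr.
by move=> le_x; apply: leq_trans le_x (leq_addl _ _).
Qed.

Lemma alt_sum_conjugate m n lam l : 0 < l < m -> is_partition_of n lam ->
  alt_sum m lam l = num_parts_congr m l (conjugate lam).
Proof.
move=> lP /and3P[slam _ _]; rewrite /num_parts_congr count_map.
by rewrite (@alt_sumE _ _ _ (head 0 lam)) //; apply/allP => x; apply: leq_head.
Qed.

(** The [m] copies of [nu] change each count of parts at least [x] by a multiple of [m]. The bound
    [a + m * b] fits both partitions, so both counts run over one range. *)
Lemma alt_sum_add_repeated m a b lam nu l : 0 < l < m ->
  is_partition_of a lam -> is_partition_of b nu ->
  alt_sum m (add_repeated m lam nu) l = alt_sum m lam l.
Proof.
move=> lP lamP nuP; have addP := add_repeated_partition m lamP nuP.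
have [slam _ /eqP sumlam] := and3P lamP.
have [sadd _ /eqP sumadd] := and3P addP.
rewrite !(@alt_sumE _ _ _ (a + m * b)) //; first last.
- by rewrite -sumadd; apply/allP => x; apply: leq_sumn.
- apply/allP => x /leq_sumn; rewrite sumlam => le_x.
  exact: leq_trans le_x (leq_addr _ _).
by apply: eq_count => x; rewrite count_add_repeated addnC mulnC modnMDl.
Qed.

Lemma num_parts_congr_add_multiples m lam nu l : 0 < l < m ->
  num_parts_congr m l (add_multiples m lam nu) = num_parts_congr m l lam.
Proof.
move=> lP; rewrite /num_parts_congr count_sort count_cat count_map.
rewrite (_ : count _ nu = 0) ?addn0 //; apply/eqP.
rewrite -leqn0 leqNgt -has_count; apply/hasPn => x _ /=.
by rewrite modnMr modn_small; lia.
Qed.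

(** * Equinumerosity for an arbitrary type *)

Definition length_type m lam : m.-1.-tuple nat :=
  [tuple num_parts_congr m l.+1 lam | l < m.-1].

(** Conjugation is an involution on the partitions of [n] that carries the alternating sum type to
    the residue counts. *)
Lemma num_partitions_alt_length_type m T n :
  num_partitions n (fun lam => alt_sum_type m lam == T) =
  num_partitions n (fun lam => length_type m lam == T).
Proof.
have typeE n' lam : is_partition_of n' lam ->
    alt_sum_type m lam = length_type m (conjugate lam).
  move=> lamP; apply/eq_from_tnth => l; rewrite !tnth_mktuple.
  by apply: alt_sum_conjugate lamP; have := ltn_ord l; lia.
rewrite !num_partitionsE -!size_filter -(size_map conjugate).
apply/perm_size/uniq_perm; rewrite ?filter_uniq ?partitions_uniq //.
  rewrite map_inj_in_uniq ?filter_uniq ?partitions_uniq // => lam mu.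
  rewrite !mem_filter !mem_partitions => /andP[_ /conjugateK eq_lam].
  by move=> /andP[_ /conjugateK eq_mu] eqc; rewrite -eq_lam eqc.
move=> lam; rewrite mem_filter mem_partitions.
apply/mapP/andP => [[mu + ->]|[lamT lamP]].
  rewrite mem_filter mem_partitions => /andP[muT muP].
  by rewrite -(typeE _ _ muP) conjugate_partition.
exists (conjugate lam); last by rewrite (conjugateK lamP).
rewrite mem_filter mem_partitions conjugate_partition // andbT.
by rewrite (typeE _ _ (conjugate_partition lamP)) (conjugateK lamP).
Qed.

(** Convolved with the partition function, the two sides count all partitions with alternating sum
    type [T] and all those with residue counts [T], which are equally many. *)
Lemma num_partitions_alt_sum_type m (T : m.-1.-tuple nat) n : 0 < m ->
  num_partitions n (fun lam =>
    (alt_sum_type m lam == T) && parts_occur_at_most (m - 1) lam) =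
  num_partitions n (fun lam =>
    (length_type m lam == T) && no_part_divisible m lam).
Proof.
move=> m_gt0; move: n.
apply: (convolution_cancel (p := num_partitions^~ predT) m_gt0 num_partitions0).
move=> n /=.
transitivity (num_partitions n (fun lam => alt_sum_type m lam == T)).
  symmetry.
  apply: (num_partitions_glaisher
            (P := fun lam => alt_sum_type m lam == T)) => //.
  move=> a b lam nu lamP nuP.
  congr (_ == T); apply/eq_from_tnth => l; rewrite !tnth_mktuple.
  by apply: alt_sum_add_repeated lamP nuP; have := ltn_ord l; lia.
rewrite num_partitions_alt_length_type.
apply: (num_partitions_regular (P := fun lam => length_type m lam == T)) => //.
move=> a b lam nu lamP nuP.
congr (_ == T); apply/eq_from_tnth => l; rewrite !tnth_mktuple.
by apply: num_parts_congr_add_multiples; have := ltn_ord l; lia.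
Qed.

(** * The type supported on two indices *)

(** Parts not divisible by [m] have residues from 1 to [m - 1], so zero entries away from [i] and
    [j] force every part into one of these two classes. *)
Lemma regular_two_entry_length_type m i j Sigma lam :
  3 <= m -> 1 <= i <= m - 1 -> 1 <= j <= m - 1 -> i <> j ->
  (length_type m lam == two_entry_type m i j Sigma) && no_part_divisible m lam =
  [&& no_part_divisible m lam,
      num_parts_congr m i lam == Sigma,
      num_parts_congr m j lam == 1
    & all (fun x => (x == i %[mod m]) || (x == j %[mod m])) lam].
Proof.
move=> hm hi hj hij; have m_gt0 : 0 < m by lia.
rewrite andbC; case: (boolP (no_part_divisible m lam)) => //= reg.
have resE r : 0 < r < m -> r %% m = r by move=> rP; rewrite modn_small //; lia.
apply/eqP/and3P => [typeE | [/eqP iE /eqP jE /allP ijP]].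
  have entry r : 0 < r < m -> num_parts_congr m r lam =
      if r == i then Sigma else if r == j then 1 else 0.
    move=> rP; have lt_r : r.-1 < m.-1 by lia.
    have := congr1 (fun T => tnth T (Ordinal lt_r)) typeE.
    by rewrite !tnth_mktuple /= prednK //; lia.
  split; rewrite ?entry ?eqxx //; try lia.
    by rewrite ifN //; lia.
  (* The residue of [x] is itself an index; were it neither [i] nor [j], its entry 0 would
     contradict the presence of [x]. *)
  apply/allP => x xlam; have mx : 0 < x %% m < m.
    by rewrite ltn_pmod // lt0n (allP reg).
  have := entry _ mx; rewrite [i %% m]resE ?[j %% m]resE; try lia.
  case: eqP => //= _; case: eqP => //= _ /eqP.
  rewrite -leqn0 leqNgt -has_count => /hasPn/(_ x xlam).
  by rewrite modn_mod eqxx.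
apply/eq_from_tnth => l; rewrite !tnth_mktuple.
have lP := ltn_ord l.
case: eqP => [->//|li]; case: eqP => [->//|lj].
apply/eqP; rewrite -leqn0 leqNgt -has_count; apply/hasPn => x /ijP.
by rewrite (resE i) ?(resE j) ?(resE l.+1); lia.
Qed.

Theorem theorem3p2 (m i j Sigma n : nat)
    (hm : 3 <= m) (hi : 1 <= i <= m - 1) (hj : 1 <= j <= m - 1)
    (hij : i <> j) (hSigma : 0 < Sigma) :
  num_partitions n (fun lam =>
    parts_occur_at_most (m - 1) lam
    && (alt_sum_type m lam == two_entry_type m i j Sigma))
  =
  num_partitions n (fun lam =>
    [&& no_part_divisible m lam,
        num_parts_congr m i lam == Sigma,
        num_parts_congr m j lam == 1
      & all (fun x => (x == i %[mod m]) || (x == j %[mod m])) lam]).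
Proof.
have m_gt0 : 0 < m by lia.
under eq_num_partitions => lam _ do rewrite andbC.
rewrite num_partitions_alt_sum_type //.
apply: eq_num_partitions => lam _.
exact: regular_two_entry_length_type.
Qed.
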